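(* Suppose $X$ is a Polish space, $\kappa$ is a cardinal, $\lambda\in\{\aleph_0,\aleph_1\}$, and that $\dagger(X,\lambda,\kappa)$ holds. If $\langle X,\preceq\rangle$ is a Borel quasi order with the property that for every $x\in X$, $|\{y\in X:y\preceq x\}|<\lambda$, then $\mathrm{odim}_B(\langle X,\preceq\rangle)\leq\kappa$.
   Context: A partial order is an irreflexive transitive relation. $[P]^{<\lambda}$ denotes the collection of subsets of $P$ of cardinality less than $\lambda$. A sequence $\langle <_i:i\in I\rangle$ of partial orders on a set $P$ separates points from elements of $[P]^{<\lambda}$ if for every $A\in[P]^{<\lambda}$ and $p\in P\setminus A$ there exists $i\in I$ so that $q<_i p$ for all $q\in A$. For a Polish space $X$ and cardinals $\lambda,\kappa$, $\dagger(X,\lambda,\kappa)$ holds if there is a sequence $\langle <_i:i<\kappa\rangle$ of Borel partial orders on $X$ (i.e. partial orders that are Borel subsets of $X\times X$) which separates points from elements of $[X]^{<\lambda}$. A quasi order on a set $P$ is a reflexive transitive relation $\leq$ on $P$; $\langle P,\leq\rangle$ is then called a quasi order. For a quasi order $\leq$ on $P$: $x \, E_{\leq} \, y$ iff ($x \leq y$ and $y \leq x$); $x<y$ iff ($x\leq y$ and $y \nleq x$); $<$ induces a partial order on $P/E_{\leq}$, also denoted $<$, by $[x]<[y]$ iff $x<y$. A quasi order $\langle P,\leq\rangle$ is Borel if $P$ is a Polish space and $\leq$ is a Borel subset of $P\times P$. A partial order $<'$ on a set $Q$ extends a partial order $<$ on $Q$ if $<\ \subseteq\ <'$. Borel order dimension: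 let $\mathcal{P}=\langle P,\leq\rangle$ be a Borel quasi order. A partial order $\prec$ on the quotient $P/E_{\leq}$ is Borel if there is a Borel quasi order $\preceq'$ on $P$ with $E_{\preceq'}=E_{\leq}$ such that $\prec$ is the partial order on $P/E_{\preceq'}=P/E_{\leq}$ induced by $\preceq'$. $\mathrm{odim}_B(\mathcal{P})$ is the minimal cardinal $\mu$ such that there is a sequence $\langle <_i : i\in\mu\rangle$ of Borel partial orders on $P/E_{\leq}$ extending $<$ such that for all $x,y\in P$ there is $i\in\mu$ with ($[y]<_i[x]$ or $[x]<[y]$ or $[x]=[y]$). *)

(* Defs.v *)
From mathcomp Require Import all_boot all_order all_algebra.
From mathcomp Require Import boolp classical_sets functions cardinality.
From mathcomp Require Import reals topology measure.

Set Implicit Arguments.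
Unset Strict Implicit.
Unset Printing Implicit Defensive.

Local Open Scope classical_set_scope.
Local Open Scope card_scope.

(** Cardinals are represented by types: a type [L] stands for the cardinality
    of [[set: L]], and a sequence of length kappa is a family indexed by a type
    of cardinality kappa. *)

Definition card_lt (T U : Type) (A : set T) (B : set U) : Prop :=
  A #<= B /\ ~ (B #<= A).

Definition is_aleph0 (L : Type) : Prop := [set: L] #= [set: nat].

Definition is_aleph1 (L : Type) : Prop :=
  ~ countable [set: L] /\
  forall M : Type, ~ countable [set: M] -> [set: L] #<= [set: M].

Definition separable (X : topologicalType) : Prop :=
  exists2 D : set X, countable D & dense D.

Definition complete_metric (R : realType) (M : metricType R) : Prop :=
  forall F : set_system M, ProperFilter F -> cauchy F -> exists l : M, F --> l.

Definition completely_metrizable (R : realType) (X : topologicalType) : Prop :=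
  exists (M : metricType R) (f : X -> M) (g : M -> X),
    [/\ complete_metric M, cancel f g, cancel g f, continuous f & continuous g].

Definition polish (R : realType) (X : topologicalType) : Prop :=
  separable X /\ completely_metrizable R X.

Definition borel (X : topologicalType) (A : set X) : Prop :=
  <<s (open : set_system X) >> A.

Definition borel_rel (X : topologicalType) (r : X -> X -> Prop) : Prop :=
  borel [set p : X * X | r p.1 p.2].

Definition partial_order (P : Type) (lt : P -> P -> Prop) : Prop :=
  (forall x, ~ lt x x) /\ (forall x y z, lt x y -> lt y z -> lt x z).

Definition quasi_order (P : Type) (le : P -> P -> Prop) : Prop :=
  (forall x, le x x) /\ (forall x y z, le x y -> le y z -> le x z).

Definition borel_quasi_order (X : topologicalType) (le : X -> X -> Prop) : Prop :=
  quasi_order le /\ borel_rel le.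

Definition order_extends (P : Type) (lt lt' : P -> P -> Prop) : Prop :=
  forall x y, lt x y -> lt' x y.

Definition separates_points (P I L : Type) (lt : I -> P -> P -> Prop) : Prop :=
  forall (A : set P) (p : P), card_lt A [set: L] -> ~ A p ->
    exists i : I, forall q, A q -> lt i q p.

Definition dagger (X : topologicalType) (L K : Type) : Prop :=
  exists lt : K -> X -> X -> Prop,
    (forall i, partial_order (lt i) /\ borel_rel (lt i)) /\
    separates_points L lt.

Definition qo_equiv (P : Type) (le : P -> P -> Prop) (x y : P) : Prop :=
  le x y /\ le y x.

Definition qo_lt (P : Type) (le : P -> P -> Prop) (x y : P) : Prop :=
  le x y /\ ~ le y x.

Definition quotient (P : Type) (E : P -> P -> Prop) : Type :=
  {C : set P | exists x, C = [set y | E x y]}.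

Definition cls (P : Type) (E : P -> P -> Prop) (x : P) : quotient E :=
  exist _ [set y | E x y] (ex_intro _ x erefl).

(** The order induced by [le] on the quotient by [E].  The relation [E] is kept
    separate from [qo_equiv le] so that quasi orders with extensionally equal
    equivalences induce orders on one and the same type. *)
Definition induced_lt (P : Type) (E : P -> P -> Prop) (le : P -> P -> Prop)
    (C D : quotient E) : Prop :=
  exists x y, [/\ C = cls E x, D = cls E y & qo_lt le x y].

Definition borel_quotient_order (X : topologicalType) (le : X -> X -> Prop)
    (prec : quotient (qo_equiv le) -> quotient (qo_equiv le) -> Prop) : Prop :=
  partial_order prec /\
  exists le' : X -> X -> Prop,
    [/\ borel_quasi_order le',
        forall x y, qo_equiv le' x y <-> qo_equiv le x y
      & forall C D, prec C D <-> induced_lt le' C D].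

Definition borel_realizer (X : topologicalType) (le : X -> X -> Prop)
    (I : Type) : Prop :=
  exists prec : I -> quotient (qo_equiv le) -> quotient (qo_equiv le) -> Prop,
    (forall i, borel_quotient_order (prec i) /\
               order_extends (@induced_lt X (qo_equiv le) le) (prec i)) /\
    forall x y : X, let c := cls (qo_equiv le) in
      exists i, [\/ prec i (c y) (c x), induced_lt le (c x) (c y) | c x = c y].

(** [M] has cardinality odim_B(X, le). *)
Definition is_odimB (X : topologicalType) (le : X -> X -> Prop) (M : Type) : Prop :=
  borel_realizer le M /\
  forall N : Type, borel_realizer le N -> [set: M] #<= [set: N].

(* Main.v *)
Require Import Defs.
From mathcomp Require Import all_boot all_order all_algebra.
From mathcomp Require Import boolp classical_sets functions cardinality.
From mathcomp Require Import reals topology measure.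
From mathcomp Require Import zify lra.
From Stdlib Require Cantor.

(** Let [lt i] be Borel partial orders which separate points from small sets,
    and write [pred x] for the set of the [w] with [le w x].  For each [i], put
    [x] below [y] when [le x y], or when some [z] in [pred y] is [lt i]-above
    all of [pred x].  This is a quasi order which contains [le] and has the same
    equivalence: such a [z] cannot lie in [pred x], since [lt i] is irreflexive.
    If [le x y] fails then [x] is outside the small set [pred y], so that some
    [lt i] puts [x] above all of [pred y], and the [i]-th extension puts [y]
    strictly below [x].  Hence these extensions, indexed by [K], realize the
    dimension, and [exists_minimal_cardinal] provides the least cardinal.

    It remains to see that the extensions are Borel, which is where the
    countability of [pred x] matters: the definition quantifies over [pred x]
    and [pred y], and the projection of a Borel set along countable sections is
    Borel ([borel_countable_projection], a form of the Lusin-Novikov theorem).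
    That theorem is proved in the Baire space.

    - A Borel set is the injective projection of a closed set
      ([borel_liftable]), so that closed sets suffice.
    - Disjoint analytic sets are separated by Borel sets
      ([analytic_separation]), so that an analytic partial function extends to
      a total Borel one ([borel_extension]).
    - Let [F] be closed and not covered by countably many Borel functions of the
      base point.  Say that a set of finite tuples of points of [F], all above
      the same base point, is small if countably many Borel functions meet every
      tuple.  A set of tuples which is not small can be refined so that a given
      entry of the tuple is split into two distinct close entries, without
      becoming small ([config_split]): otherwise that entry would be, off a
      small set, a function of the base point, with analytic graph, hence given
      by a Borel function.  Iterating yields, above one base point, a sequence
      of points of [F] which is dense in itself, and by the Baire category
      argument that section of [F] is uncountable
      ([closed_uniformization]).

    A Polish space reduces to the Baire space by sending a point to the sequence
    of the indices of its first approximations in a dense sequence; this is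
    injective, has Borel range, and identifies the Borel relations
    ([polish_coding]). *)

Set Implicit Arguments.
Unset Strict Implicit.
Unset Printing Implicit Defensive.

Local Open Scope classical_set_scope.
Local Open Scope card_scope.

(** * Generated sigma-algebras *)

Section GeneratedSigmaAlgebra.
Context (T : Type) (G : set (set T)).
Local Notation S := (<<s G >>).

Lemma sigma_not (P : T -> Prop) : S P -> S (fun x => ~ P x).
Proof.
move=> SP; have [_ hC _] := smallest_sigma_algebra setT G.
suff -> : (fun x => ~ P x) = setT `\` P by exact: hC.
by apply/funext => x; apply/propext; split => [|[]].
Qed.

Lemma sigma_exists (P : nat -> T -> Prop) :
  (forall n, S (P n)) -> S (fun x => exists n, P n x).
Proof.
move=> SP; have [_ _ hU] := smallest_sigma_algebra setT G.
suff -> : (fun x => exists n, P n x) = \bigcup_n P n by exact: hU.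
by apply/funext => x; apply/propext; split => [[n Pn]|[n _ Pn]]; exists n.
Qed.

Lemma sigma_forall (P : nat -> T -> Prop) :
  (forall n, S (P n)) -> S (fun x => forall n, P n x).
Proof.
move=> SP; suff -> : (fun x => forall n, P n x) =
    (fun x => ~ exists n, ~ P n x).
  by apply: sigma_not; apply: sigma_exists => n; exact: sigma_not.
by apply/funext => x; apply/propext; rewrite -forallNE; split => h n;
  have := h n; rewrite not_notE.
Qed.

Lemma sigma_const (P : Prop) : S (fun=> P).
Proof.
have [S0 _ _] := smallest_sigma_algebra setT G.
have [p|np] := pselect P.
  suff -> : (fun=> P) = (fun x : T => ~ set0 x) by exact: sigma_not.
  by apply/funext => x; apply/propext; split=> // _ [].
suff -> : (fun=> P) = set0 :> set T by [].
by apply/funext => x; apply/propext; split.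
Qed.

Lemma sigma_or (P Q : T -> Prop) : S P -> S Q -> S (fun x => P x \/ Q x).
Proof.
move=> SP SQ; suff -> : (fun x => P x \/ Q x) =
    (fun x => exists n, (if n is 0 then P else Q) x).
  by apply: sigma_exists => -[|n].
apply/funext => x; apply/propext; split => [[p|q]|[[|n]]].
- by exists 0.
- by exists 1.
- by left.
- by right.
Qed.

Lemma sigma_and (P Q : T -> Prop) : S P -> S Q -> S (fun x => P x /\ Q x).
Proof.
move=> SP SQ; suff -> : (fun x => P x /\ Q x) =
    (fun x => forall n, (if n is 0 then P else Q) x).
  by apply: sigma_forall => -[|n].
apply/funext => x; apply/propext; split => [[p q] [|n] //|h].
by split; [exact: (h 0)|exact: (h 1)].
Qed.

End GeneratedSigmaAlgebra.

Lemma sigma_preimage (T U : Type) (G : set (set T)) (H : set (set U))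
    (f : U -> T) :
  (forall A, G A -> <<s H >> (fun u => A (f u))) ->
  forall A, <<s G >> A -> <<s H >> (fun u => A (f u)).
Proof.
move=> GH A GA; apply: (GA [set B | <<s H >> (fun u => B (f u))]); split => //.
split => [|B|F] /=.
- exact: (@sigma_const U H False).
- move=> HB; suff -> : (fun u => (setT `\` B) (f u)) = (fun u => ~ B (f u)).
    exact: sigma_not.
  by apply/funext => u; apply/propext; split => [[]|].
- move=> HF; suff -> : (fun u => (\bigcup_k F k) (f u)) =
      (fun u => exists k, F k (f u)) by exact: sigma_exists.
  by apply/funext => u; apply/propext; split => [[k _ ?]|[k ?]]; exists k.
Qed.

(** * The Baire space *)

Definition baire := nat -> nat.

Definition baire_cylinder : set (set baire) :=
  [set A | exists n m, A = (fun a => a n = m)].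

Definition borelB (A : baire -> Prop) : Prop := <<s baire_cylinder >> A.

Definition borel_map (T : Type) (G : set (set T)) (f : T -> baire) : Prop :=
  forall i k, <<s G >> (fun x => f x i = k).

Lemma borel_map_preimage (T : Type) (G : set (set T)) (f : T -> baire)
    (A : baire -> Prop) :
  borel_map G f -> borelB A -> <<s G >> (fun x => A (f x)).
Proof.
by move=> Gf; apply: sigma_preimage => _ [n [m ->]]; exact: Gf.
Qed.

Lemma borelB_coord n m : borelB (fun a => a n = m).
Proof. by apply: sub_sigma_algebra; exists n, m. Qed.

Lemma borel_map_reindex (T : Type) (G : set (set T)) (f : T -> baire)
    (g : nat -> nat) :
  borel_map G f -> borel_map G (fun x => f x \o g).
Proof. by move=> Gf i k; exact: Gf. Qed.

Lemma borel_map_id : borel_map baire_cylinder id.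
Proof. exact: borelB_coord. Qed.

Lemma borel_map_eq (T : Type) (G : set (set T)) (f g : T -> baire) :
  borel_map G f -> borel_map G g -> <<s G >> (fun x => f x = g x).
Proof.
move=> Gf Gg; suff -> : (fun x => f x = g x) =
    (fun x => forall i, exists k, f x i = k /\ g x i = k).
  by apply: sigma_forall => i; apply: sigma_exists => k; exact: sigma_and.
apply/funext => x; apply/propext; split => [-> i|h]; first by exists (g x i).
by apply/funext => i; have [k [-> ->]] := h i.
Qed.

Lemma borel_map_comp (T : Type) (G : set (set T)) (f : baire -> baire)
    (g : T -> baire) :
  borel_map baire_cylinder f -> borel_map G g -> borel_map G (f \o g).
Proof.
by move=> Bf Gg i k; exact: (borel_map_preimage Gg (Bf i k)).
Qed.

(** ** Countably many points coded in one *)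

Definition code (c i : nat) : nat := Cantor.to_nat (c, i).

Definition decode (n : nat) : nat * nat := Cantor.of_nat n.

Lemma codeK c i : decode (code c i) = (c, i).
Proof. exact: Cantor.cancel_of_to. Qed.

Lemma decodeK n : code (decode n).1 (decode n).2 = n.
Proof. by rewrite /code -surjective_pairing; exact: Cantor.cancel_to_of. Qed.

Lemma leq_code c i : c <= code c i /\ i <= code c i.
Proof. by have := Cantor.to_nat_non_decreasing c i; rewrite /code; lia. Qed.

Definition column (c : nat) (a : baire) : baire := a \o code c.

Definition of_columns (f : nat -> baire) : baire :=
  fun n => f (decode n).1 (decode n).2.

Lemma column_of_columns f c : column c (of_columns f) = f c.
Proof. by apply/funext => i; rewrite /column /of_columns /= codeK. Qed.

Lemma eq_columns a b : (forall c, column c a = column c b) -> a = b.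
Proof.
move=> ab; apply/funext => n; rewrite -(decodeK n).
exact: (congr1 (@^~ (decode n).2) (ab (decode n).1)).
Qed.

Definition pairB (a b : baire) : baire :=
  of_columns (fun c => if c == 0 then a else if c == 1 then b else fun=> 0).

Lemma column_pair0 a b : column 0 (pairB a b) = a.
Proof. exact: column_of_columns. Qed.

Lemma column_pair1 a b : column 1 (pairB a b) = b.
Proof. exact: column_of_columns. Qed.

Lemma borel_map_column (T : Type) (G : set (set T)) (f : T -> baire) c :
  borel_map G f -> borel_map G (fun x => column c (f x)).
Proof. exact: borel_map_reindex. Qed.

Lemma borel_map_pair (T : Type) (G : set (set T)) (f g : T -> baire) :
  borel_map G f -> borel_map G g -> borel_map G (fun x => pairB (f x) (g x)).
Proof.
move=> Gf Gg i k; rewrite /pairB /of_columns.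
case: eqP => _; first exact: Gf.
by case: eqP => _; [exact: Gg|exact: sigma_const].
Qed.

(** ** Closed sets *)

Definition agree (n : nat) (a b : baire) : Prop := forall i, i < n -> a i = b i.

Definition closedB (F : baire -> Prop) : Prop :=
  forall a, (forall n, exists2 b, F b & agree n a b) -> F a.

Lemma agree_le m n a b : m <= n -> agree n a b -> agree m a b.
Proof. by move=> mn ab i im; apply: ab; lia. Qed.

Lemma agree_reindex (g : nat -> nat) m :
  exists n, forall a b, agree n a b -> agree m (a \o g) (b \o g).
Proof.
exists (\max_(i < m) (g i).+1) => a b ab i im /=; apply: ab.
exact: (leq_bigmax (Ordinal im)).
Qed.

Lemma closedB_reindex (g : nat -> nat) F :
  closedB F -> closedB (fun a => F (a \o g)).
Proof.
move=> Fc a h; apply: Fc => m; have [n nP] := agree_reindex g m.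
by have [b Fb ab] := h n; exists (b \o g) => //; exact: nP.
Qed.

Lemma closedB_column c F : closedB F -> closedB (fun a => F (column c a)).
Proof. exact: closedB_reindex. Qed.

Lemma closedB_forall (I : Type) (F : I -> baire -> Prop) :
  (forall i, closedB (F i)) -> closedB (fun a => forall i, F i a).
Proof.
move=> Fc a h i; apply: Fc => n.
by have [b Fb ab] := h n; exists b => //; exact: Fb.
Qed.

Lemma closedB_and F H :
  closedB F -> closedB H -> closedB (fun a => F a /\ H a).
Proof.
move=> Fc Hc a h; split; [apply: Fc|apply: Hc] => n.
  by have [b [Fb _] ab] := h n; exists b.
by have [b [_ Hb] ab] := h n; exists b.
Qed.

Lemma closedB_local n (F : baire -> Prop) :
  (forall a b, agree n a b -> F b -> F a) -> closedB F.
Proof. by move=> Fl a h; have [b Fb ab] := h n; exact: Fl ab Fb. Qed.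

Lemma closedB_eq (g h : nat -> nat) : closedB (fun a => a \o g = a \o h).
Proof.
have -> : (fun a : baire => a \o g = a \o h) =
    (fun a => forall i, a (g i) = a (h i)).
  apply/funext => a; apply/propext; split => [e i|e].
    exact: (congr1 (@^~ i) e).
  by apply/funext => i; exact: e.
apply: closedB_forall => i; apply: (@closedB_local (g i + h i).+1) => a b ab.
by rewrite !ab //; lia.
Qed.

(** ** Borel sets as injective projections of closed sets *)

Definition closed_lift (A F : baire -> Prop) : Prop :=
  [/\ closedB F, forall z, A z <-> exists2 u, F u & column 0 u = z
    & forall u v, F u -> F v -> column 0 u = column 0 v -> u = v].

Definition liftable (A : baire -> Prop) : Prop := exists F, closed_lift A F.

Lemma closed_liftable A : closedB A -> liftable A.
Proof.
move=> Ac; exists (fun u => A (column 0 u) /\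
  forall c, column c.+1 u = fun=> 0); split.
- apply: closedB_and; first exact: closedB_column.
  apply: closedB_forall => c.
  apply: (@closedB_reindex (code c.+1) (fun a => a = fun=> 0)).
  move=> a h; apply/funext => i; have [b -> ab] := h i.+1; exact: ab.
- move=> z; split => [Az|[u [Au _] <-] //].
  exists (of_columns (fun c => if c is 0 then z else fun=> 0)); last first.
    by rewrite column_of_columns.
  by split => [|c]; rewrite column_of_columns.
- move=> u v [_ u0] [_ v0] uv; apply: eq_columns => -[|c] //.
  by rewrite u0 v0.
Qed.

Lemma liftable_forall (A : nat -> baire -> Prop) :
  (forall k, liftable (A k)) -> liftable (fun z => forall k, A k z).
Proof.
move=> /choice[F FA].
exists (fun u => forall k, F k (column k.+1 u) /\
  column 0 (column k.+1 u) = column 0 u); split.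
- apply: closedB_forall => k; apply: closedB_and.
    by apply: closedB_column; have [] := FA k.
  exact: (@closedB_eq (code k.+1 \o code 0) (code 0)).
- move=> z; split => [Az|[u Fu <-] k]; last first.
    have [Fk e] := Fu k; have [_ Ak _] := FA k; apply/Ak.
    by exists (column k.+1 u).
  have /choice[u uP] : forall k, exists u, F k u /\ column 0 u = z.
    move=> k; have [_ Ak _] := FA k; have /Ak[u Fu uz] := Az k.
    by exists u.
  exists (of_columns (fun c => if c is k.+1 then u k else z)); last first.
    by rewrite column_of_columns.
  by move=> k; rewrite !column_of_columns; exact: uP.
- move=> u v Fu Fv uv; apply: eq_columns => -[|k] //.
  have [_ _ inj] := FA k; have [Fuk euk] := Fu k; have [Fvk evk] := Fv k.
  by apply: inj => //; rewrite euk evk.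
Qed.

Lemma liftable_and A B :
  liftable A -> liftable B -> liftable (fun z => A z /\ B z).
Proof.
move=> LA LB; have : liftable (fun z => forall k, (if k is 0 then A else B) z).
  by apply: liftable_forall => -[].
congr liftable; apply/funext => z; apply/propext; split => [h|[a b] [|k] //].
by split; [exact: (h 0)|exact: (h 1)].
Qed.

(** Disjointness lets a lift record the index of the unique piece containing
    the point, without losing uniqueness. *)
Lemma liftable_disjoint_exists (A : nat -> baire -> Prop) :
  (forall k, liftable (A k)) ->
  (forall k l z, A k z -> A l z -> k = l) ->
  liftable (fun z => exists k, A k z).
Proof.
move=> /choice[F FA] disj; pose idx (u : baire) := u (code 2 0).
exists (fun u => [/\ F (idx u) (column 1 u), column 0 (column 1 u) = column 0 u
  & forall c, column c.+2 u = fun=> idx u]); split.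
- suff : closedB (fun u => F (idx u) (column 1 u) /\
    (column 0 (column 1 u) = column 0 u /\
     forall c, column c.+2 u = fun=> idx u)).
    congr closedB; apply/funext => u; apply/propext.
    by split => [[? []]|[]].
  apply: closedB_and; last apply: closedB_and.
  + move=> a h; have [cF _ _] := FA (idx a).
    have {}cF := @closedB_column 1 _ cF; apply: (cF a) => n.
    have [b Fb ab] := h (maxn n (code 2 0).+1).
    have -> : idx a = idx b by apply: ab; lia.
    by exists b => //; apply: agree_le ab; lia.
  + exact: (@closedB_eq (code 1 \o code 0) (code 0)).
  + apply: closedB_forall => c.
    exact: (@closedB_eq (code c.+2) (fun=> code 2 0)).
- move=> z; split => [[k Akz]|[u [Fu u0 _] <-]]; last first.
    exists (idx u); have [_ Ak _] := FA (idx u); apply/Ak.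
    by exists (column 1 u).
  have [_ Ak _] := FA k; have /Ak[v Fv vz] := Akz.
  exists (of_columns (fun c => match c with 0 => z | 1 => v | _ => fun=> k end)).
    have e : idx (of_columns (fun c => match c with
        0 => z | 1 => v | _ => fun=> k end)) = k.
      by rewrite /idx /of_columns codeK.
    by rewrite e; split => [||c]; rewrite !column_of_columns.
  by rewrite column_of_columns.
- move=> u v [Fu u0 uc] [Fv v0 vc] uv.
  have e : idx u = idx v.
    have [_ Au _] := FA (idx u); have [_ Av _] := FA (idx v).
    apply: (disj _ _ (column 0 u)); [apply/Au|apply/Av].
      by exists (column 1 u).
    by exists (column 1 v) => //; rewrite v0.
  apply: eq_columns => -[|[|c]] //; last by rewrite uc vc e.
  have [_ _ inj] := FA (idx u); apply: inj => //; first by rewrite e.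
  by rewrite u0 v0.
Qed.

(** Sets which, together with their complement, are liftable form a
    sigma-algebra: a countable union is made disjoint by removing from each
    piece the previous ones. *)
Lemma borel_liftable A : borelB A -> liftable A.
Proof.
move=> BA; suff : liftable A /\ liftable (fun z => ~ A z) by case.
move: A BA; apply: smallest_sub; last first.
  move=> _ [n [m ->]]; split; apply: closed_liftable;
  by apply: (@closedB_local n.+1) => a b /(_ n (leqnn _)) ->.
have lset0 : liftable (fun=> False) by apply: closed_liftable => a /(_ 0) [].
have lsetT : liftable (fun=> True) by apply: closed_liftable.
split => [|A [LA LAc]|A LA].
- split => //; congr liftable: lsetT.
  by apply/funext => z; apply/propext; split => // _ [].
- split.
    congr liftable: LAc; apply/funext => z.
    by apply/propext; split => [|[]].
  congr liftable: LA; apply/funext => z.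
  apply/propext; split => [Az [_]//|/not_andP[|/contrapT//]].
  by case.
- split; last first.
    have := liftable_forall (fun k => (LA k).2).
    congr liftable; apply/funext => z; apply/propext; split => [h [k _]|h k Ak].
      exact: h.
    by apply: h; exists k.
  pose B k z := A k z /\ forall j, j < k -> ~ A j z.
  have LB k : liftable (B k).
    apply: liftable_and; first by case: (LA k).
    apply: liftable_forall => j; case: ltnP => jk.
      have := (LA j).2; congr liftable.
      by apply/funext => z; apply/propext; split => // /(_ isT).
    by move: lsetT; congr liftable; apply/funext => z; apply/propext; split.
  have := liftable_disjoint_exists LB _.
  have -> : (fun z => exists k, B k z) = \bigcup_k A k.
    apply/funext => z; apply/propext; split => [[k [Ak _]]|[k _ Ak]].
      by exists k.
    have ex : exists k, `[< A k z >] by exists k; apply/asboolP.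
    exists (ex_minn ex); case: ex_minnP => m /asboolP Am mmin.
    split => // j jm /asboolP /mmin; lia.
  apply=> k l z [Ak kmin] [Al lmin].
  case: (ltngtP k l) => // kl.
    by case: (lmin _ kl).
  by case: (kmin _ kl).
Qed.

(** ** Construction of branches *)

Lemma branch_of_extendible (T : Type) (N : seq T -> Prop) :
  N [::] -> (forall s, N s -> exists t, N (rcons s t)) ->
  exists a : nat -> T, forall n, N (mkseq a n).
Proof.
move=> N0 Nr; have /choice[h hP] : forall s : {s | N s},
    exists t, N (rcons (sval s) t) by move=> [s /= /Nr].
pose st s : {s | N s} := exist _ _ (hP s).
pose b n := iter n st (exist _ _ N0).
exists (fun n => h (b n)) => n.
suff -> : mkseq (fun n => h (b n)) n = sval (b n) by exact: svalP.
by elim: n => // n IH; rewrite mkseqS IH.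
Qed.

Lemma mkseq_agree n (a b : baire) : mkseq a n = mkseq b n <-> agree n a b.
Proof.
split => [ab i im|ab]; first by rewrite -(nth_mkseq 0 a im) ab nth_mkseq.
apply: (@eq_from_nth _ 0); rewrite !size_mkseq // => i im.
by rewrite !nth_mkseq // ab.
Qed.

Definition through (s : seq nat) (a : baire) : Prop := mkseq a (size s) = s.

Lemma through_mkseq n a b : through (mkseq a n) b <-> agree n a b.
Proof.
rewrite /through size_mkseq mkseq_agree.
by split=> h i im; rewrite h.
Qed.

Lemma through_rcons s a : through s a -> through (rcons s (a (size s))) a.
Proof. by rewrite /through size_rcons mkseqS => ->. Qed.

(** * Separation of disjoint analytic sets *)

Definition borel_separated (A B : baire -> Prop) : Prop :=
  exists C, [/\ borelB C, forall x, A x -> C x & forall x, B x -> ~ C x].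

Lemma borel_separated_sub (A B A' B' : baire -> Prop) :
  (forall x, A x -> A' x) -> (forall x, B x -> B' x) ->
  borel_separated A' B' -> borel_separated A B.
Proof.
by move=> AA BB [C [Cb AinC BnC]]; exists C; split => // x;
  [move/AA; exact: AinC|move/BB; exact: BnC].
Qed.

Lemma borel_separated_exists (A B : nat -> baire -> Prop) :
  (forall i j, borel_separated (A i) (B j)) ->
  borel_separated (fun x => exists i, A i x) (fun x => exists j, B j x).
Proof.
move=> sep; have /choice[C CP] : forall p : nat * nat, exists C,
    [/\ borelB C, forall x, A p.1 x -> C x & forall x, B p.2 x -> ~ C x].
  by move=> [i j]; exact: sep.
exists (fun x => exists i, forall j, C (i, j) x); split.
- apply: sigma_exists => i; apply: sigma_forall => j.
  by case: (CP (i, j)).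
- by move=> x [i Ai]; exists i => j; case: (CP (i, j)) => _ + _; apply.
- move=> x [j Bj] [i /(_ j)].
  by case: (CP (i, j)) => _ _; apply.
Qed.

Definition image_through (F : baire -> Prop) (g : nat -> nat) (s : seq nat)
    (x : baire) : Prop :=
  exists u, [/\ F u, through s u & u \o g = x].

Lemma closedB_branch F g (u : baire) : closedB F ->
  (forall n, exists x, image_through F g (mkseq u n) x) -> F u.
Proof.
move=> Fc h; apply: Fc => n; have [x [v [Fv /through_mkseq uv _]]] := h n.
by exists v.
Qed.

(** If the two images were inseparable, one could choose successively the
    coordinates of a point of each closed set so that the pieces above their
    initial segments remain inseparable; but the two limit points have
    different images, which a cylinder separates. *)
Lemma analytic_separation (F H : baire -> Prop) (g : nat -> nat) :
  closedB F -> closedB H -> (forall u v, F u -> H v -> u \o g <> v \o g) ->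
  borel_separated (fun x => exists2 u, F u & u \o g = x)
                  (fun x => exists2 u, H u & u \o g = x).
Proof.
move=> Fc Hc disj; apply: contrapT => nsep.
pose N (t : seq (nat * nat)) := ~ borel_separated
  (image_through F g (unzip1 t)) (image_through H g (unzip2 t)).
have [|t Nt|a Na] := @branch_of_extendible _ N.
- apply: contra_not nsep; apply: borel_separated_sub => x [u Fu ux];
  by exists u.
- (* the pieces are countable unions of those above longer segments *)
  apply: contrapT => ext; apply: Nt.
  apply: (@borel_separated_sub _ _
    (fun x => exists i, image_through F g (rcons (unzip1 t) i) x)
    (fun x => exists j, image_through H g (rcons (unzip2 t) j) x)).
  + move=> x [u [Fu tu ux]]; exists (u (size (unzip1 t))), u.
    by split => //; exact: through_rcons.
  + move=> x [u [Fu tu ux]]; exists (u (size (unzip2 t))), u.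
    by split => //; exact: through_rcons.
  apply: borel_separated_exists => i j; apply: contrapT => nij.
  by apply: ext; exists (i, j); rewrite /N /unzip1 /unzip2 !map_rcons.
- pose u n := (a n).1; pose v n := (a n).2.
  have {}Na n : ~ borel_separated (image_through F g (mkseq u n))
                                  (image_through H g (mkseq v n)).
    by have := Na n; rewrite /N /unzip1 /unzip2 /mkseq -!map_comp.
  have Fu : F u.
    apply: (@closedB_branch F g u) => // n; apply: contrapT => no.
    apply: (Na n); exists (fun=> False).
    split => [|x Ax|x _] //; first exact: sigma_const.
    by apply: no; exists x.
  have Hv : H v.
    apply: (@closedB_branch H g v) => // n; apply: contrapT => no.
    apply: (Na n); exists (fun=> True).
    split => [|x _|x Bx] //; first exact: sigma_const.
    by move=> _; apply: no; exists x.
  have [i uvi] : exists i, u (g i) <> v (g i).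
    apply: contrapT => e; apply: (disj u v Fu Hv); apply/funext => i /=.
    by apply: contrapT => uvi; apply: e; exists i.
  apply: (Na (g i).+1); exists (fun x => x i = u (g i)); split.
  + exact: borelB_coord.
  + by move=> _ [w [_ /through_mkseq uw <-]] /=; rewrite uw.
  + by move=> _ [w [_ /through_mkseq vw <-]] /=; rewrite -vw // => /esym.
Qed.

Lemma borel_image_separation (A B : baire -> Prop) :
  borelB A -> borelB B ->
  (forall u v, A u -> B v -> column 0 u <> column 0 v) ->
  borel_separated (fun x => exists2 u, A u & column 0 u = x)
                  (fun x => exists2 u, B u & column 0 u = x).
Proof.
move=> /borel_liftable[F [Fc AF _]] /borel_liftable[H [Hc BH _]] disj.
have := @analytic_separation F H (code 0 \o code 0) Fc Hc.
have e (E K : baire -> Prop) :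
    (forall z, E z <-> exists2 u, K u & column 0 u = z) ->
    (fun x => exists2 u, K u & u \o (code 0 \o code 0) = x) =
    (fun x => exists2 u, E u & column 0 u = x).
  move=> EK; apply/funext => x; apply/propext; split.
    by move=> [u Ku <-]; exists (column 0 u) => //; apply/EK; exists u.
  by move=> [_ /EK[u Ku <-] <-]; exists u.
rewrite (e A) // (e B) //; apply => u v Fu Hv.
by apply: (disj (column 0 u) (column 0 v)); [apply/AF; exists u|apply/BH; exists v].
Qed.

(** Among countably many Borel sets, the index of one containing the point can
    be selected in a Borel way. *)
Lemma borel_index (E : nat -> baire -> Prop) : (forall k, borelB (E k)) ->
  exists f : baire -> nat, (forall k, borelB (fun x => f x = k)) /\
    forall x k, E k x -> E (f x) x.
Proof.
move=> EB.
have /choice[f fP] : forall x, exists k,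
    (E k x /\ forall l, l < k -> ~ E l x) \/ (k = 0 /\ forall l, ~ E l x).
  move=> x; have [ex|nex] := pselect (exists k, E k x); last first.
    by exists 0; right; split => // l El; apply: nex; exists l.
  have ex' : exists k, `[< E k x >] by case: ex => k Ek; exists k; apply/asboolP.
  exists (ex_minn ex'); left; case: ex_minnP => m /asboolP Em mmin.
  by split => // l lm /asboolP /mmin; lia.
exists f; split => [k|x k Ek]; last first.
  by have [[] //|[_ /(_ k)]] := fP x.
suff -> : (fun x => f x = k) = (fun x =>
    (E k x /\ forall l, ~ (l < k /\ E l x)) \/ (k = 0 /\ forall l, ~ E l x)).
  apply: sigma_or; apply: sigma_and.
  - exact: EB.
  - apply: sigma_forall => l; apply: sigma_not; apply: sigma_and; last exact: EB.
    exact: sigma_const.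
  - exact: sigma_const.
  - by apply: sigma_forall => l; apply: sigma_not; exact: EB.
apply/funext => x; apply/propext; split => [<-|].
  have [[Ef fmin]|?] := fP x; last by right.
  by left; split => // l [lf]; exact: fmin.
case=> [[Ek kmin]|[-> no]].
  have [[Ef fmin]|[_ /(_ k)] //] := fP x.
  case: (ltngtP (f x) k) => // h; first by case: (kmin (f x)).
  by case: (fmin k h).
by have [[/no]|[]] := fP x.
Qed.

(** An analytic partial function extends to a total Borel one: its
    coordinates are determined by separating the disjoint analytic sets on
    which they take different values. *)
Lemma borel_extension (Q : baire -> Prop) c : borelB Q ->
  (forall u v, Q u -> Q v -> column 0 u = column 0 v -> column c u = column c v) ->
  exists2 f : baire -> baire, borel_map baire_cylinder f &
    forall u, Q u -> f (column 0 u) = column c u.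
Proof.
move=> QB Qf; pose D i k u := Q u /\ column c u i = k.
have DB i k : borelB (D i k).
  by apply: sigma_and => //; exact: borel_map_column borel_map_id i k.
have /choice[C CP] : forall p : nat * nat * nat, exists C, p.1.2 <> p.2 ->
    [/\ borelB C, forall u, D p.1.1 p.1.2 u -> C (column 0 u)
      & forall u, D p.1.1 p.2 u -> ~ C (column 0 u)].
  move=> [[i k] l] /=; have [->|kl] := pselect (k = l); first by exists setT.
  have [|C [CB DC DnC]] := @borel_image_separation (D i k) (D i l) (DB i k) (DB i l).
    by move=> u v [Qu uk] [Qv vl] uv; apply: kl; rewrite -uk -vl (Qf u v).
  by exists C => _; split => // u Du; [apply: DC|apply: DnC]; exists u.
pose E i k x := forall l, k <> l -> C (i, k, l) x.
have EB i k : borelB (E i k).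
  apply: sigma_forall => l; have [kl|kl] := pselect (k = l).
    suff -> : (fun x => k <> l -> C (i, k, l) x) = (fun=> True).
      exact: sigma_const.
    by apply/funext => x; apply/propext; split.
  suff -> : (fun x => k <> l -> C (i, k, l) x) = C (i, k, l).
    by case: (CP (i, k, l)).
  by apply/funext => x; apply/propext; split => // h; exact: h.
have /choice[f fP] := fun i => borel_index (EB i).
exists (fun x i => f i x) => [i k|u Qu]; first exact: (fP i).1.
apply/funext => i; set x := column 0 u; set k := column c u i.
have Du : D i k u by [].
have Ek : E i k x by move=> l kl; have [_ + _] := CP (i, k, l) kl; apply.
have Ef := (fP i).2 x k Ek.
(* the set [E i l] containing [x] cannot have [l] different from [k] *)
apply: contrapT => fk; have [_ _] := CP (i, f i x, k) fk.
by move=> /(_ u Du); apply; exact: Ef.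
Qed.

(** * Uniformization of closed sets with countable sections *)

Lemma countable_enum (T : Type) (A : set T) (t0 : T) : countable A ->
  exists p : nat -> T, forall t, A t -> exists k, p k = t.
Proof.
move=> /pcard_leP[f].
have /choice[p pP] : forall k, exists t, (exists2 u, A u & f u = k) ->
    A t /\ f t = k.
  move=> k; have [[u Au fu]|no] := pselect (exists2 u, A u & f u = k).
    by exists u.
  by exists t0 => /no.
exists p => t At; exists (f t); have [|Ap fp] := pP (f t); first by exists t.
by apply: (@inj _ _ _ f) fp; rewrite inE.
Qed.

Lemma countable_injective (T U : Type) (A : set T) (B : set U) (h : T -> U) :
  (forall t, A t -> B (h t)) ->
  (forall s t, A s -> A t -> h s = h t -> s = t) ->
  countable B -> countable A.
Proof.
move=> AB hinj /countable_injP[f finj]; apply/countable_injP.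
exists (f \o h) => s t; rewrite !inE => As At /= e.
by apply: hinj => //; apply: finj e; rewrite inE; exact: AB.
Qed.

(** The Baire category argument: one can approach, along the points [y j], a
    point of [C] which avoids every member of a given enumeration. *)
Lemma closed_dense_in_itself_uncountable (C : baire -> Prop)
    (y : nat -> baire) :
  closedB C -> (forall j, C (y j)) ->
  (forall j m, exists2 k, agree m (y j) (y k) & y j <> y k) ->
  ~ countable (C : set baire).
Proof.
move=> Cc Cy dense /(countable_enum (y 0))[p pP].
have /choice[step stepP] : forall t : nat * nat * nat, exists t' : nat * nat,
    [/\ t.1.2 < t'.2, agree t.1.2 (y t.1.1) (y t'.1) &
        ~ agree t'.2 (y t'.1) (p t.2)].
  move=> [[j m] k] /=.
  have [j' ajj' yp] : exists2 j', agree m (y j) (y j') & y j' <> p k.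
    have [yp|] := pselect (y j = p k); last by exists j.
    by have [j' ? ne] := dense j m; exists j' => // e; apply: ne; rewrite yp.
  have [i yi] : exists i, y j' i <> p k i.
    apply: contrapT => no; apply: yp; apply/funext => i.
    by apply: contrapT => ne; apply: no; exists i.
  exists (j', maxn m.+1 i.+1); split => //=; first lia.
  by move=> /(_ i) h; apply: yi; apply: h; lia.
pose st := fix st n := if n is k.+1 then step (st k, k) else (0, 0).
have stS k : [/\ (st k).2 < (st k.+1).2,
    agree (st k).2 (y (st k).1) (y (st k.+1).1) &
    ~ agree (st k.+1).2 (y (st k.+1).1) (p k)] by exact: (stepP (st k, k)).
have le_st k : k <= (st k).2.
  by elim: k => // k IH; have [+ _ _] := stS k; lia.
have st_le k n : (st k).2 <= (st (k + n)).2.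
  elim: n => [|n IH]; first by rewrite addn0.
  by rewrite addnS; have [+ _ _] := stS (k + n); lia.
have st_agree k n : agree (st k).2 (y (st k).1) (y (st (k + n)).1).
  elim: n => [|n IH]; first by rewrite addn0.
  rewrite addnS => i ik; rewrite IH //; have [_ + _] := stS (k + n).
  by apply; have := st_le k n; lia.
pose z : baire := fun i => y (st i.+1).1 i.
have zy k : agree (st k).2 z (y (st k).1).
  move=> i ik; rewrite (st_agree k i.+1 i ik) addnC.
  exact: (st_agree i.+1 k i (le_st i.+1)).
have Cz : C z.
  by apply: Cc => n; exists (y (st n).1) => //; apply: agree_le (zy n).
have [k pk] := pP z Cz; have [_ _] := stS k; apply.
by rewrite pk => i ik; rewrite -(zy k.+1 i ik).
Qed.

Lemma through_borel s : borelB (through s).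
Proof.
suff -> : through s = (fun a => forall i, i < size s -> a i = nth 0 s i).
  apply: sigma_forall => i; case: (ltnP i (size s)) => h.
    suff -> : (fun a : baire => is_true true -> a i = nth 0 s i) =
        (fun a => a i = nth 0 s i) by exact: borelB_coord.
    by apply/funext => a; apply/propext; split => // /(_ isT).
  suff -> : (fun a : baire => is_true false -> a i = nth 0 s i) =
      (fun=> True) by exact: sigma_const.
  by apply/funext => a; apply/propext; split.
apply/funext => a; apply/propext; split => [as_ i im|h].
  by rewrite -as_ nth_mkseq.
by apply: (@eq_from_nth _ 0); rewrite size_mkseq // => i im; rewrite nth_mkseq ?h.
Qed.

Lemma closedB_borel F : closedB F -> borelB F.
Proof.
move=> Fc; pose P n m a := if unpickle m is Some s then
  [/\ size s = n, exists2 b, F b & through s b & through s a] else False.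
suff -> : F = (fun a => forall n, exists m, P n m a).
  apply: sigma_forall => n; apply: sigma_exists => m; rewrite /P.
  case: unpickle => [s|]; last exact: sigma_const.
  suff -> : (fun a => [/\ size s = n, exists2 b, F b & through s b & through s a]) =
      (fun a => (size s = n /\ exists2 b, F b & through s b) /\ through s a).
    by apply: sigma_and; [exact: sigma_const|exact: through_borel].
  by apply/funext => a; apply/propext; split => [[]|[[]]].
apply/funext => a; apply/propext; split => [Fa n|h].
  exists (pickle (mkseq a n)); rewrite /P pickleK; split.
  - exact: size_mkseq.
  - by exists a => //; apply/through_mkseq.
  - by apply/through_mkseq.
apply: Fc => n; have [m] := h n; rewrite /P.
case: unpickle => // s [sn [b Fb sb] sa]; exists b => //.
by apply/mkseq_agree; rewrite -sn sa sb.
Qed.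

Section LusinNovikov.
Context (F : baire -> Prop) (g : nat -> nat).
Context (F_closed : closedB F).

(** Every natural number is the parent of infinitely many. *)
Definition parent (k : nat) : nat := (decode k).1.

Lemma parent_le k : parent k <= k.
Proof. by rewrite -{2}(decodeK k); exact: (leq_code _ _).1. Qed.

(** [w] codes a base point, its column [0], and points [y_j] of [F] above it, its
    columns [j + 1].  The point [y_(k+1)] differs from [y_(parent k)] at [d k],
    and agrees with it at every coordinate which an initial segment of [w] of
    length [k] determines; so such a segment can be prescribed independently of
    [y_(k+1)], whose own coordinates sit at later positions. *)
Definition config (n : nat) (d : nat -> nat) (w : baire) : Prop :=
  (forall j, j <= n -> F (column j.+1 w) /\ column j.+1 w \o g = column 0 w) /\
  (forall k, k < n ->
     (forall i, code (parent k).+1 i < k ->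
        column k.+2 w i = column (parent k).+1 w i) /\
     column k.+2 w (d k) <> column (parent k).+1 w (d k)).

Definition small (n : nat) (W : baire -> Prop) : Prop :=
  exists2 f : nat -> baire -> baire,
    forall k, borel_map baire_cylinder (f k) &
    forall w, W w -> exists j k, j <= n /\ column j.+1 w = f k (column 0 w).

Lemma small_sub n (V W : baire -> Prop) :
  (forall w, V w -> W w) -> small n W -> small n V.
Proof. by move=> VW [f fB fP]; exists f => // w /VW/fP. Qed.

Lemma small_exists n (W : nat -> baire -> Prop) :
  (forall i, small n (W i)) -> small n (fun w => exists i, W i w).
Proof.
move=> Ws; have /choice[f fP] : forall i, exists f : nat -> baire -> baire,
    (forall k, borel_map baire_cylinder (f k)) /\
    forall w, W i w -> exists j k, j <= n /\ column j.+1 w = f k (column 0 w).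
  by move=> i; have [f fB fP] := Ws i; exists f.
exists (fun k => f (decode k).1 (decode k).2) => [k|w [i Wi]].
  exact: (fP _).1.
have [j [k [jn e]]] := (fP i).2 w Wi.
by exists j, (code i k); rewrite codeK.
Qed.

Lemma config_closed n d : closedB (config n d).
Proof.
apply: closedB_and.
  apply: closedB_forall => j; case: (leqP j n) => _; last first.
    by move=> a _.
  move=> a h _; split.
    apply: (@closedB_column j.+1 F F_closed) => m.
    by have [b /(_ isT)[]] := h m; exists b.
  apply: (@closedB_eq (code j.+1 \o g) (code 0)) => m.
  by have [b /(_ isT)[_ e] ab] := h m; exists b.
apply: closedB_forall => k; case: (ltnP k n) => _; last by move=> a _.
move=> a h _; split => [i ik|].
  have [b /(_ isT)[e _] ab] := h (code k.+2 i + code (parent k).+1 i).+1.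
  by move: (e i ik); rewrite /column /= !ab //; lia.
have [b /(_ isT)[_ e] ab] := h (code k.+2 (d k) + code (parent k).+1 (d k)).+1.
by move: e; rewrite /column /= !ab //; lia.
Qed.

Lemma config_agree n d d' w : agree n d d' -> config n d w -> config n d' w.
Proof.
move=> dd' [h1 h2]; split => // k kn; have [a b] := h2 k kn.
by rewrite -dd'.
Qed.

Lemma config_le m n d w : m <= n -> config n d w -> config m d w.
Proof. by move=> mn [h1 h2]; split => k km; [apply: h1|apply: h2]; lia. Qed.

(** The entry [parent n] of [v] serves as the new point of [u].  Its coordinates
    are placed at positions beyond [s], so that the prescribed segment is
    unaffected. *)
Lemma config_extend n d s u v :
  config n d u -> config n d v -> size s = n -> through s u -> through s v ->
  column 0 u = column 0 v ->
  column (parent n).+1 u <> column (parent n).+1 v ->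
  exists w, [/\ exists i, config n.+1 (fun k => if k == n then i else d k) w,
    through s w, forall c, c <= n.+1 -> column c w = column c u
    & column n.+2 w = column (parent n).+1 v].
Proof.
move=> cu cv sn su sv uv ne.
have [i nei] : exists i, column (parent n).+1 u i <> column (parent n).+1 v i.
  apply: contrapT => no; apply: ne; apply/funext => i.
  by apply: contrapT => ne; apply: no; exists i.
pose w := of_columns (fun c =>
  if c == n.+2 then column (parent n).+1 v else column c u).
have wu c : c <= n.+1 -> column c w = column c u.
  by move=> cn; rewrite /w column_of_columns; case: eqP => // ?; lia.
have wv : column n.+2 w = column (parent n).+1 v.
  by rewrite /w column_of_columns eqxx.
have pn := parent_le n.
have sw : through s w.
  rewrite -su; apply/through_mkseq => l ls; rewrite /w /of_columns.
  case: eqP => [e|_]; last by rewrite /column /= decodeK.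
  by have := (leq_code (decode l).1 (decode l).2).1; rewrite decodeK; lia.
exists w; split => //; exists i; split => [j jn|k kn].
  have [jn1|jn1] := leqP j n; first by rewrite !wu ?ltnS //; exact: cu.1.
  have -> : j = n.+1 by lia.
  rewrite wv wu // uv; apply: cv.1; lia.
have pk := parent_le k; have [kn1|kn1] := ltnP k n.
  rewrite !wu; [|lia..]; rewrite ifF; last by apply/eqP; lia.
  exact: cu.2.
have -> : k = n by lia.
rewrite eqxx wv wu; last by lia.
split => [l ln|]; last by move=> /esym.
rewrite /column /=; have /through_mkseq -> // : through (mkseq u n) v.
by rewrite -sn su.
Qed.

(** If all the refinements were small, let the [f k] witness it for their union.
    On the Borel set [Q] of the configurations that no [f k] meets, entry
    [parent n] is a function of the base point: two different values would
    merge, by [config_extend], into a refinement that no [f k] meets.  This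
    function extends to a Borel one, which together with the [f k] shows that
    the given set was small. *)
Lemma config_split n d s : size s = n ->
  ~ small n (fun w => config n d w /\ through s w) ->
  exists i v, ~ small n.+1 (fun w =>
    config n.+1 (fun k => if k == n then i else d k) w /\
    through (rcons s v) w).
Proof.
move=> sn; apply: contra_notP => all_small.
have [f fB fP] : small n.+1 (fun w => exists i v,
    config n.+1 (fun k => if k == n then i else d k) w /\
    through (rcons s v) w).
  apply: small_exists => i; apply: small_exists => v.
  by apply: contrapT => h; apply: all_small; exists i, v.
pose Q w := (config n d w /\ through s w) /\
  forall j k, ~ (j <= n /\ column j.+1 w = f k (column 0 w)).
have QB : borelB Q.
  apply: sigma_and; first apply: sigma_and.
  - by apply: closedB_borel; exact: config_closed.
  - exact: through_borel.
  - apply: sigma_forall => j; apply: sigma_forall => k; apply: sigma_not.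
    apply: sigma_and; first exact: sigma_const.
    apply: borel_map_eq; first exact: borel_map_column borel_map_id.
    exact: (borel_map_comp (fB k) (borel_map_column 0 borel_map_id)).
have [|h hB hP] := @borel_extension Q (parent n).+1 QB.
  move=> u v [[cu su] nu] [[cv sv] nv] uv; apply: contrapT => ne.
  have [w [[i cw] sw wu wv]] := config_extend cu cv sn su sv uv ne.
  have [|j [k [jn]]] := fP w.
    by exists i, (w n); split => //; rewrite -sn; exact: through_rcons.
  rewrite (wu 0) //; have [jn1|jn1] := leqP j n.
    by rewrite wu // => e; apply: (nu j k).
  have -> : j = n.+1 by lia.
  rewrite wv uv => e; apply: (nv (parent n) k); split => //.
  exact: parent_le.
exists (fun k => if k is l.+1 then f l else h) => [[|k]//|w cw].
have [Qw|nQ] := pselect (Q w).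
  by exists (parent n), 0; split; [exact: parent_le|rewrite hP].
apply: contrapT => no; apply: nQ; split => // j k jk.
by apply: no; exists j, k.+1.
Qed.

(** The Lusin-Novikov theorem for a closed set.  If no countable family of Borel
    functions works then [config_split] builds a branch [w], whose points
    [y_j] all lie in one section; as every [j] is [parent k] for arbitrarily
    large [k], each [y_j] is a limit of other ones. *)
Theorem closed_uniformization :
  (forall x, countable [set u | F u /\ u \o g = x]) ->
  exists2 f : nat -> baire -> baire,
    forall k, borel_map baire_cylinder (f k) &
    forall u, F u -> exists k, u = f k (u \o g).
Proof.
move=> Fcount.
have [[f fB fP]|nsmall] := pselect (small 0 (config 0 id)).
  exists f => // u Fu; have [|j [k []]] := fP (pairB (u \o g) u).
    split => // -[|//] _; rewrite column_pair0 column_pair1; split => //.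
  rewrite leqn0 => /eqP ->; rewrite column_pair0 column_pair1.
  by exists k.
exfalso; pose N (t : seq (nat * nat)) := ~ small (size t) (fun w =>
  config (size t) (nth 0 (unzip2 t)) w /\ through (unzip1 t) w).
have [|t Nt|a Na] := @branch_of_extendible _ N.
- apply: contra_not nsmall; apply: small_sub => w cw; split => //.
  by apply: config_agree cw.
- have [|i [v ns]] := @config_split _ _ (unzip1 t) _ Nt; first by rewrite size_map.
  exists (v, i); apply: contra_not ns.
  rewrite size_rcons /unzip1 /unzip2 !map_rcons /=.
  apply: small_sub => w [cw sw]; split => //; apply: config_agree cw => k kn.
  rewrite nth_rcons size_map; case: eqP => [->|ne]; first by rewrite ltnn.
  by rewrite ifT //; lia.
pose w n := (a n).1; pose d n := (a n).2.
have cw n : config n d w.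
  apply: (@config_closed n d) => m; have := Na (maxn n m); rewrite /N size_mkseq.
  apply: contra_notP => no.
  exists (fun=> id); first by move=> k; exact: borel_map_id.
  move=> b [cb sb]; exfalso; apply: no; exists b.
    apply: (@config_le _ (maxn n m)); first lia.
    apply: config_agree cb => k km.
    by rewrite /unzip2 /mkseq -map_comp (nth_map 0) ?size_iota // nth_iota.
  move: sb; rewrite /unzip1 /mkseq -map_comp => /through_mkseq wb.
  by apply: agree_le wb; lia.
apply: (@closed_dense_in_itself_uncountable
  (fun u => F u /\ u \o g = column 0 w) (fun j => column j.+1 w)) => //.
- apply: closedB_and => // b h; apply/funext => i.
  by have [c <- bc] := h (g i).+1; exact: bc.
- by move=> j; exact: (cw j).1.
- (* a [k] with parent [j], larger than the positions of the first [m]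
     coordinates of [y_j] *)
  move=> j m; pose k := code j (\max_(i < m) code j.+1 i).+1.
  have pk : parent k = j by rewrite /parent codeK.
  have [yk ne] := (cw k.+1).2 k (leqnn _); rewrite pk in yk ne.
  exists k.+1 => [i im|e]; last by apply: ne; rewrite e.
  rewrite yk //; have := (leq_code j (\max_(i < m) code j.+1 i).+1).2.
  exact: leq_trans (leq_bigmax (Ordinal im)).
- exact: Fcount.
Qed.

End LusinNovikov.

(** Lifting a Borel set to a closed one does not change the size of its
    sections, since the lift is injective. *)
Theorem borel_countable_projection (Q : baire -> Prop) : borelB Q ->
  (forall x, countable [set u | Q u /\ column 0 u = x]) ->
  borelB (fun x => exists2 u, Q u & column 0 u = x).
Proof.
move=> QB Qcount; have [F [Fc QF Finj]] := borel_liftable QB.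
pose g := code 0 \o code 0.
have [x|f fB fP] := @closed_uniformization F g Fc.
  apply: (@countable_injective _ _ _ _ (column 0) _ _ (Qcount x)) => [u|u v] [Fu ux].
    by split => //; apply/QF; exists u.
  by move=> [Fv _]; exact: Finj.
suff -> : (fun x => exists2 u, Q u & column 0 u = x) =
    (fun x => exists k, F (f k x) /\ f k x \o g = x).
  apply: sigma_exists => k; apply: sigma_and.
    exact: (borel_map_preimage (fB k) (closedB_borel Fc)).
  apply: borel_map_eq; last exact: borel_map_id.
  exact: borel_map_reindex (fB k).
apply/funext => x; apply/propext; split => [[_ /QF[u Fu <-] <-]|[k [Fk e]]].
  by have [k e] := fP u Fu; exists k; rewrite -[column 0 _]/(u \o g) -e.
by exists (column 0 (f k x)) => //; apply/QF; exists (f k x).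
Qed.

(** * Coding a Polish space by a Borel subset of the Baire space *)

Import Order.TTheory GRing.Theory Num.Theory.
Local Open Scope ring_scope.

Definition rad (R : realType) (k : nat) : R := k.+1%:R^-1.
Arguments rad {R} k.

Lemma rad_gt0 (R : realType) k : 0 < rad k :> R.
Proof. by rewrite invr_gt0. Qed.

Lemma rad_small (R : realType) (e : R) : 0 < e -> exists k, rad k < e.
Proof.
move=> e0; exists (Num.truncn e^-1); rewrite /rad.
by rewrite invf_plt ?posrE //; exact: truncnS_gt.
Qed.

Lemma rad_le (R : realType) j k : (j <= k)%N -> rad k <= rad j :> R.
Proof. by move=> jk; rewrite lef_pV2 ?posrE // ler_nat. Qed.

Section PolishCoding.
Context (R : realType) (X : topologicalType).
Context (dist : X -> X -> R) (s : nat -> X).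
Context (dist_eq : forall x y, dist x y = 0 -> x = y).
Context (dist_ge0 : forall x y, 0 <= dist x y).
Context (dist_sym : forall x y, dist x y = dist y x).
Context (dist_triangle : forall x y z, dist x z <= dist x y + dist y z).
Context (dist_dense : forall x (e : R), 0 < e ->
  exists n, dist x (s n) < e).
Context (dist_complete : forall y : nat -> X,
  (forall j k, dist (y j) (y k) < rad j + rad k) ->
  exists x, forall j, dist x (y j) <= rad j).
Context (dist_open : forall x e, open [set y | dist x y < e]).
Context (nbhs_dist : forall x A, nbhs x A ->
  exists2 e : R, 0 < e & forall y, dist x y < e -> A y).

Lemma address_exists x : exists a : baire, forall k,
  dist x (s (a k)) < rad k /\ forall m, (m < a k)%N -> ~ dist x (s m) < rad k.
Proof.
have : forall k, exists n, dist x (s n) < rad k /\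
    forall m, (m < n)%N -> ~ dist x (s m) < rad k; last first.
  by move=> /choice[a aP]; exists a.
move=> k; have ex := dist_dense x (rad_gt0 R k).
exists (ex_minn ex); case: ex_minnP => n xn nmin; split => // m mn /nmin.
by lia.
Qed.

(** The [k]-th coordinate of the address of [x] is the index of the first point
    of the dense sequence within distance [rad k] of [x]. *)
Definition address (x : X) : baire := sval (cid (address_exists x)).

Lemma address_near x k : dist x (s (address x k)) < rad k.
Proof. by rewrite /address; case: cid => a /= /(_ k)[]. Qed.

Lemma address_unique x (a : baire) :
  (forall k, dist x (s (a k)) < rad k /\
     forall m, (m < a k)%N -> ~ dist x (s m) < rad k) ->
  address x = a.
Proof.
rewrite /address; case: cid => b /= bP aP; apply/funext => k.
have [bk bmin] := bP k; have [ak amin] := aP k.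
case: (ltngtP (b k) (a k)) => // h; first by case: (amin _ h).
by case: (bmin _ h).
Qed.

Lemma address_coord x k m : address x k = m <->
  dist x (s m) < rad k /\ forall l, ~ ((l < m)%N /\ dist x (s l) < rad k).
Proof.
rewrite /address; case: cid => b /= /(_ k)[bk bmin]; split => [<-|[mk mmin]].
  by split => // l [lb]; exact: bmin.
case: (ltngtP (b k) m) => // h; first by case: (mmin (b k)).
by case: (bmin _ h).
Qed.

Lemma address_inj : injective address.
Proof.
move=> x y e; apply: dist_eq; apply/eqP; rewrite eq_le dist_ge0 andbT.
rewrite leNgt; apply/negP => d0.
have [k kd] := @rad_small R (dist x y / 2) ltac:(lra).
have xk := address_near x k; have yk := address_near y k.
rewrite e in xk; rewrite dist_sym in yk.
have := dist_triangle x (s (address y k)) y; lra.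
Qed.

Lemma borelB_coord2 (C : nat -> nat -> Prop) i j :
  borelB (fun a => C (a i) (a j)).
Proof.
suff -> : (fun a : baire => C (a i) (a j)) =
    (fun a => exists p q, (a i = p /\ a j = q) /\ C p q).
  apply: sigma_exists => p; apply: sigma_exists => q.
  apply: sigma_and; last exact: sigma_const.
  by apply: sigma_and; exact: borelB_coord.
apply/funext => a; apply/propext; split => [aC|[p [q [[-> ->]]]] //].
by exists (a i), (a j).
Qed.

(** Membership in the range is expressed through distances between points of
    the dense sequence only: if [x] is the limit of the [s (a j)] then
    [dist x (s m) < rad k] means that some [j] satisfies
    [dist (s (a j)) (s m) < rad k - rad j]. *)
Lemma range_address_borel : borelB (fun a => exists x, address x = a).
Proof.
suff -> : (fun a => exists x, address x = a) = (fun a =>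
    (forall j k, dist (s (a j)) (s (a k)) < rad j + rad k) /\
    (forall k, (exists j, dist (s (a j)) (s (a k)) < rad k - rad j) /\
       forall m j, ~ ((m < a k)%N /\ dist (s (a j)) (s m) < rad k - rad j))).
  apply: sigma_and.
    apply: sigma_forall => j; apply: sigma_forall => k.
    exact: (borelB_coord2 (fun p q => dist (s p) (s q) < rad j + rad k)).
  apply: sigma_forall => k; apply: sigma_and.
    apply: sigma_exists => j.
    exact: (borelB_coord2 (fun p q => dist (s p) (s q) < rad k - rad j)).
  apply: sigma_forall => m; apply: sigma_forall => j; apply: sigma_not.
  exact: (borelB_coord2
    (fun p q => (m < p)%N /\ dist (s q) (s m) < rad k - rad j)).
have limP x (a : baire) k m : (forall j, dist x (s (a j)) <= rad j) ->
    dist x (s m) < rad k <-> exists j, dist (s (a j)) (s m) < rad k - rad j.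
  move=> xa; split => [xm|[j am]].
    have [j jr] := @rad_small R ((rad k - dist x (s m)) / 2) ltac:(lra).
    exists j; have := dist_triangle (s (a j)) x (s m).
    by rewrite (dist_sym (s (a j)) x); have := xa j; lra.
  by have := dist_triangle x (s (a j)) (s m); have := xa j; lra.
apply/funext => a; apply/propext; split => [[x <-]|[Ca aP]].
  have xa j : dist x (s (address x j)) <= rad j by exact/ltW/address_near.
  split => [j k|k].
    have := dist_triangle (s (address x j)) x (s (address x k)).
    rewrite (dist_sym (s _) x).
    by have := address_near x j; have := address_near x k; lra.
  have [xk xmin] := (address_coord x k (address x k)).1 erefl.
  split => [|m j [mk xm]]; first exact/(limP _ _ _ _ xa).
  by apply: (xmin m); split => //; apply/(limP _ _ _ _ xa); exists j.
have [x xa] := dist_complete Ca; exists x; apply: address_unique => k.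
have [ak amin] := aP k; split => [|m mk /(limP _ _ _ _ xa)[j am]].
  exact/(limP _ _ _ _ xa).
exact: (amin m j).
Qed.

Lemma address_borel (Y : topologicalType) (h : Y -> X) : continuous h ->
  borel_map (open : set_system Y) (fun y => address (h y)).
Proof.
move=> hc k m.
have ball_borel n : <<s (open : set_system Y) >>
    (fun y => dist (h y) (s n) < rad k).
  apply: sub_sigma_algebra.
  suff -> : (fun y => dist (h y) (s n) < rad k : Prop) =
      h @^-1` [set x | dist (s n) x < rad k].
    by apply: open_comp => // y _; exact: hc.
  by apply/funext => y; rewrite /preimage /= dist_sym.
suff -> : (fun y => address (h y) k = m) = (fun y => dist (h y) (s m) < rad k /\
    forall l, ~ ((l < m)%N /\ dist (h y) (s l) < rad k)).
  apply: sigma_and => //; apply: sigma_forall => l; apply: sigma_not.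
  by apply: sigma_and => //; exact: sigma_const.
by apply/funext => y; apply/propext; exact: address_coord.
Qed.

Definition address2 (p : X * X) : baire := pairB (address p.1) (address p.2).

Lemma address2_borel : borel_map (open : set_system (X * X)%type) address2.
Proof.
by apply: borel_map_pair; apply: address_borel => p;
  [exact: cvg_fst|exact: cvg_snd].
Qed.

(** An open set is the union of the products of balls that it contains whose
    centers belong to the dense sequence, and the addresses provide centers
    near the two coordinates with arbitrarily small radius. *)
Lemma open_address2 (W : set (X * X)) : open W ->
  exists2 V, borelB V & forall p, W p <-> V (address2 p).
Proof.
move=> Wo; pose box k i j := forall p,
  dist p.1 (s i) < rad k -> dist p.2 (s j) < rad k -> W p.
exists (fun a => exists k, box k (column 0 a k) (column 1 a k)).
  by apply: sigma_exists => k; exact: borelB_coord2.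
move=> [x y]; rewrite /address2 /= column_pair0 column_pair1.
split => [Wxy|[k kbox]]; last by apply: kbox; exact: address_near.
have [[A B] [/= Ax By] ABW] : nbhs (x, y) W by exact: open_nbhs_nbhs.
have [e e0 eA] := nbhs_dist Ax; have [d d0 dB] := nbhs_dist By.
have [k kr] := @rad_small R (Num.min e d / 2)
  ltac:(rewrite divr_gt0 // lt_min e0 d0 //).
have {}kr : rad k * 2 < e /\ rad k * 2 < d.
  by apply/andP; rewrite -lt_min -ltr_pdivlMr.
exists k => -[x' y'] /= xk yk; apply: ABW; split => /=.
  apply: eA; have := dist_triangle x (s (address x k)) x'.
  by rewrite (dist_sym (s _) x'); have := address_near x k; lra.
apply: dB; have := dist_triangle y (s (address y k)) y'.
by rewrite (dist_sym (s _) y'); have := address_near y k; lra.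
Qed.

Lemma borel_address2 (W : set (X * X)) :
  borel W <-> exists2 V, borelB V & forall p, W p <-> V (address2 p).
Proof.
split => [|[V VB WV]]; last first.
  have -> : W = (fun p => V (address2 p)).
    by apply/funext => p; apply/propext.
  exact: (borel_map_preimage address2_borel).
move: W; apply: smallest_sub => [|W]; last exact: open_address2.
split => [|A [V VB AV]|A] /=.
- by exists (fun=> False) => //; exact: sigma_const.
- exists (fun a => ~ V a) => [|p]; first exact: sigma_not.
  by rewrite -AV; split => [[]|].
- move=> AV; have /choice[V VP] : forall k, exists V,
      borelB V /\ forall p, A k p <-> V (address2 p).
    by move=> k; have [V ? ?] := AV k; exists V.
  exists (fun a => exists k, V k a) => [|p].
    by apply: sigma_exists => k; exact: (VP k).1.
  by split => [[k _ /(VP k).2 Vk]|[k /(VP k).2 Ak]]; exists k.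
Qed.

End PolishCoding.

Theorem polish_coding (R : realType) (X : topologicalType) : polish R X ->
  exists e : X -> baire, [/\ injective e,
    borelB (fun a => exists x, e x = a) &
    forall r : X -> X -> Prop, borel_rel r <->
      exists2 V, borelB V & forall x y, r x y <-> V (pairB (e x) (e y))].
Proof.
move=> [[D Dcount Ddense] [M [f [g [Mcompl fK gK fc gc]]]]].
(* an empty space has no dense sequence and is treated apart *)
have [[x0 _]|X0] := pselect (exists x : X, True); last first.
  have X_empty (x : X) : False by apply: X0; exists x.
  exists (fun x => match X_empty x with end); split.
  - by move=> x; case: (X_empty x).
  - suff -> : (fun a : baire => exists x : X, match X_empty x with end = a) =
        (fun=> False) by exact: sigma_const.
    by apply/funext => a; apply/propext; split => // -[x]; case: (X_empty x).
  - move=> r; split => _.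
      exists (fun=> False); first exact: sigma_const.
      by move=> x; case: (X_empty x).
    rewrite /borel_rel; suff -> : [set p : X * X | r p.1 p.2] = (fun=> False).
      exact: sigma_const.
    by apply/funext => -[x]; case: (X_empty x).
pose dist x y : R := mdist (f x) (f y).
have dist_sym x y : dist x y = dist y x by exact: metric_sym.
have dist_triangle x y z : dist x z <= dist x y + dist y z.
  exact: metric_triangle.
have dist_xx x : dist x x = 0 by exact: mdistxx.
have dist_open x e : open [set y | dist x y < e].
  rewrite openE => y /= xy.
  have yb : nbhs y (f @^-1` ball (f y) (e - dist x y)).
    by apply: fc; apply: nbhsx_ballx; rewrite subr_gt0.
  rewrite /interior; apply: filterS yb => z; rewrite /= ballEmdist /= => yz.
  by have := dist_triangle x y z; rewrite -/(dist y z) in yz; lra.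
have nbhs_dist x A : nbhs x A ->
    exists2 e : R, 0 < e & forall y, dist x y < e -> A y.
  move=> xA; have : nbhs (f x) (g @^-1` A) by apply: gc; rewrite fK.
  move=> /nbhs_ballP[e /= e0 eA]; exists e => // y xy.
  by rewrite -(fK y); apply: eA; rewrite ballEmdist.
have [s sP] := countable_enum x0 Dcount.
have dist_dense x (e : R) : 0 < e -> exists n, dist x (s n) < e.
  move=> e0; have [|y [xy /sP[n ny]]] := Ddense _ _ (dist_open x e).
    by exists x; rewrite /= dist_xx.
  by exists n; rewrite ny.
have dist_complete (y : nat -> X) :
    (forall j k, dist (y j) (y k) < rad j + rad k) ->
    exists x, forall j, dist x (y j) <= rad j.
  move=> yC; pose F : set_system M := (f \o y) @ \oo.
  have [|l Fl] := Mcompl F _.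
    apply/cauchyP => e e0; have [k kr] := @rad_small R (e / 2) ltac:(lra).
    exists (f (y k)), k => // n /= kn; rewrite ballEmdist /=.
    by have := yC k n; have := rad_le R kn; rewrite /dist; lra.
  exists (g l) => j; apply/ler_addgt0Pl => e e0.
  have [N _ NP] : F (ball l (e / 2)) by apply: Fl; apply: nbhsx_ballx; lra.
  have [k kr] := @rad_small R (e / 2) ltac:(lra).
  have := NP (maxn N k) (leq_maxl _ _); rewrite /= ballEmdist /= => ln.
  have lr := rad_le R (leq_maxr N k); have := yC (maxn N k) j.
  have := dist_triangle (g l) (y (maxn N k)) (y j).
  by rewrite {2}/dist gK; lra.
exists (address dist_dense); split.
- apply: address_inj dist_triangle _ => // [x y /mdist_positivity|x y].
    exact: can_inj fK _ _.
  exact: mdist_ge0.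
- exact: range_address_borel.
- move=> r; rewrite /borel_rel.
  have [rV Vr] := borel_address2 dist_sym dist_triangle dist_dense dist_open
    nbhs_dist [set p | r p.1 p.2].
  split => [/rV[V VB rP]|[V VB rP]].
    by exists V => // x y; exact: (rP (x, y)).
  by apply: Vr; exists V => // -[x y]; exact: rP.
Qed.

Local Close Scope ring_scope.

(** * Minimal cardinals *)

Lemma card_le_injective (T U : Type) (h : T -> U) : injective h ->
  [set: T] #<= [set: U].
Proof.
move=> hinj; have /Pinj[i _] : {in [set: T] &, injective h}.
  by move=> x y _ _; exact: hinj.
have := card_image i; rewrite card_eq_le => /andP[_ /card_le_trans]; apply.
exact: subset_card_le.
Qed.

(** Take a maximal family of choice functions which pairwise differ at every
    type.  By maximality it exhausts some type [M], and reading the functions at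
    another type [N] injects [M] into [N]. *)
Lemma exists_minimal_cardinal (S : Type -> Prop) (K : Type) : S K ->
  exists M : Type, S M /\ forall N : Type, S N -> [set: M] #<= [set: N].
Proof.
move=> SK; pose F := forall i : {N : Type | S N}, sval i.
pose P (A : set F) := forall f g, A f -> A g -> forall i, f i = g i -> f = g.
have [|A [PA Amax]] := @Zorn_bigcup F P.
  move=> C CP Ctot f g [A CA Af] [B CB Bg] i.
  have [AB|BA] := Ctot A B CA CB.
    by apply: (CP B CB) => //; exact: AB.
  by apply: (CP A CA) => //; exact: BA.
have [i iP] : exists i, forall t : sval i, exists2 f, A f & f i = t.
  apply: contrapT => no.
  have new i : {t : sval i | forall f, A f -> f i <> t}.
    apply: cid; apply: contrapT => old; apply: no; exists i => t.
    apply: contrapT => Aold; apply: old; exists t => f Af ft.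
    by apply: Aold; exists f.
  pose h : F := fun i => sval (new i).
  have hP i f : A f -> f i <> h i by rewrite /h; case: (new i) => /= t; apply.
  apply: (Amax (A `|` [set h])).
    split; first by move=> f Af; left.
    move=> /(_ h) /(_ (or_intror erefl)) Ah.
    exact: (hP (exist _ K SK) h Ah).
  move=> f g [Af|->] [Ag|->] j //; first exact: PA.
    by move/(hP _ _ Af).
  by move/esym/(hP _ _ Ag).
exists (sval i); split => [|N SN]; first exact: svalP.
have /choice[sel selP] : forall t : sval i, exists f, A f /\ f i = t.
  by move=> t; have [f] := iP t; exists f.
apply: (@card_le_injective _ _ (fun t => sel t (exist _ N SN))) => t u tu.
have [At <-] := selP t; have [Au <-] := selP u.
by rewrite (PA _ _ At Au _ tu).
Qed.

(** If [A] were uncountable, the minimality of [aleph_1] would inject [L] in it. *)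
Lemma countable_below (L T : Type) (A : set T) :
  is_aleph0 L \/ is_aleph1 L -> card_lt A [set: L] -> countable A.
Proof.
move=> hL [AL LA]; case: hL => [L0|[_ Lmin]].
  by apply: card_le_trans AL _; move: L0; rewrite /is_aleph0 card_eq_le => /andP[].
apply: contrapT => Auncount; apply: LA.
have eA : [set: A] #= A by exact: card_setT.
move: (eA); rewrite card_eq_le => /andP[leA geA].
apply: card_le_trans (Lmin A _) leA => Acount.
exact: Auncount (card_le_trans geA Acount).
Qed.

(** * Borel relations on a Polish space *)

Lemma borel_rel_swap (X : topologicalType) (r : X -> X -> Prop) :
  borel_rel r -> borel_rel (fun x y => r y x).
Proof.
apply: (@sigma_preimage _ _ open open (fun p : X * X => (p.2, p.1))) => A Ao.
apply: sub_sigma_algebra.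
apply: (@open_comp _ _ (fun p : X * X => (p.2, p.1))) => // p _.
by apply: cvg_pair; [exact: cvg_snd|exact: cvg_fst].
Qed.

(** In the Baire space, [Q] collects the codes of the triples [((x, z), w)] with
    [r1 w x] and [r2 w z].  Restricting [x] and [w] to the range of the
    coding, which is Borel, keeps the sections countable. *)
Lemma borel_rel_exists_countable (R : realType) (X : topologicalType)
    (r1 r2 : X -> X -> Prop) : polish R X -> borel_rel r1 -> borel_rel r2 ->
  (forall x, countable [set w | r1 w x]) ->
  borel_rel (fun x z => exists w, r1 w x /\ r2 w z).
Proof.
move=> /polish_coding[e [e_inj e_range eP]] /eP[V1 V1B r1P] /eP[V2 V2B r2P] rcount.
pose Q u := ((exists w, e w = column 1 u) /\
    (exists x, e x = column 0 (column 0 u))) /\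
  ((V1 (pairB (column 1 u) (column 0 (column 0 u))) /\
    V2 (pairB (column 1 u) (column 1 (column 0 u)))) /\
   u = pairB (column 0 u) (column 1 u)).
have col c : borel_map baire_cylinder (column c).
  exact: borel_map_column borel_map_id.
have col0 c : borel_map baire_cylinder (fun u => column c (column 0 u)).
  exact: borel_map_column (col 0).
have QB : borelB Q.
  apply: sigma_and; apply: sigma_and.
  - exact: (borel_map_preimage (col 1) e_range).
  - exact: (borel_map_preimage (col0 0) e_range).
  - apply: sigma_and.
      exact: (borel_map_preimage (borel_map_pair (col 1) (col0 0)) V1B).
    exact: (borel_map_preimage (borel_map_pair (col 1) (col0 1)) V2B).
  - by apply: borel_map_eq; [exact: borel_map_id|exact: borel_map_pair].
apply/eP; exists (fun v => exists2 u, Q u & column 0 u = v).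
  apply: borel_countable_projection => // v.
  have [[x xv]|no] := pselect (exists x, e x = column 0 v); last first.
    suff -> : [set u | Q u /\ column 0 u = v] = set0 by exact: countable0.
    apply/funext => u; apply/propext; split => // -[[[_ [x xu] _] uv]].
    by apply: no; exists x; rewrite xu uv.
  apply: sub_countable (rcount x).
  apply: card_le_trans (card_image_le (fun w => pairB v (e w)) _).
  apply: subset_card_le => u [[[[w wu] _] [[V1u _] uE]] uv].
  exists w; last by rewrite wu -uv -uE.
  by apply/r1P; rewrite wu xv -uv.
move=> x z; split => [[w [/r1P V1w /r2P V2w]]|[u [[[w wu] _] [[V1u V2u] _]] uE]].
  exists (pairB (pairB (e x) (e z)) (e w)); last by rewrite column_pair0.
  rewrite /Q !(column_pair0, column_pair1).
  by split; split => //; [exists w|exists x].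
exists w; move: V1u V2u; rewrite uE -wu column_pair0 column_pair1.
by move=> /r1P ? /r2P.
Qed.

(** * Orders induced on the quotient *)

Lemma cls_eq (P : Type) (E : P -> P -> Prop) (x y : P) :
  (forall z, E z z) -> cls E x = cls E y -> E x y.
Proof.
move=> Erefl /(congr1 sval) /= exy.
have : [set z | E y z] y by exact: Erefl.
by rewrite -exy.
Qed.

Lemma eq_cls (P : Type) (E : P -> P -> Prop) (x y : P) :
  (forall u v, E u v -> E v u) -> (forall u v w, E u v -> E v w -> E u w) ->
  E x y -> cls E x = cls E y.
Proof.
move=> Esym Etrans exy; apply: eq_exist.
apply/funext => z; apply/propext; split; last exact: Etrans.
exact: Etrans (Esym _ _ exy).
Qed.

Lemma induced_lt_partial_order (P : Type) (E le : P -> P -> Prop) :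
  quasi_order le -> (forall x y, E x y <-> qo_equiv le x y) ->
  partial_order (@induced_lt P E le).
Proof.
move=> [le_refl le_trans] EP.
have Erefl z : E z z by apply/EP.
have Ecls x y : cls E x = cls E y -> E x y by exact: cls_eq.
split => [C [x [y [Cx Cy [_ nyx]]]]|].
  by apply: nyx; have /EP[] : E x y by apply: Ecls; rewrite -Cx.
move=> C D C' [x [y [Cx Dy [xy nyx]]]] [x' [y' [Dx' Cy' [xy' nyx']]]].
have /EP[yx' x'y] : E y x' by apply: Ecls; rewrite -Dy.
exists x, y'; split => //; split.
  exact: le_trans xy (le_trans _ _ _ yx' xy').
move=> y'x; apply: nyx'; apply: le_trans y'x (le_trans _ _ _ xy yx').
Qed.

(** * Extending a quasi order along a separating partial order *)

Section Extension.
Context (P : Type) (le lt : P -> P -> Prop).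
Context (le_qo : quasi_order le) (lt_po : partial_order lt).

Definition dominated_extension (x y : P) : Prop :=
  le x y \/ exists z, le z y /\ forall w, le w x -> lt w z.

Lemma dominated_extension_quasi_order : quasi_order dominated_extension.
Proof.
have [le_refl le_trans] := le_qo; have [_ lt_trans] := lt_po.
split => [x|x y u]; first by left.
case=> [xy|[z [zy xz]]] [yu|[z' [zu yz']]].
- by left; exact: le_trans xy yu.
- by right; exists z'; split => // w wx; apply: yz'; exact: le_trans wx xy.
- by right; exists z; split => //; exact: le_trans zy yu.
- by right; exists z'; split => // w /xz wz; apply: lt_trans wz (yz' z zy).
Qed.

(** A pair added to [le] is never reversed: if [z] below [v] dominates all the
    predecessors of [u], then [v] below [u] would put [z] below itself for
    [lt]. *)
Lemma dominated_extension_equiv x y :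
  qo_equiv dominated_extension x y <-> qo_equiv le x y.
Proof.
have [le_refl le_trans] := le_qo; have [lt_irr lt_trans] := lt_po.
have irr u v z : le z v -> (forall w, le w u -> lt w z) ->
    ~ dominated_extension v u.
  move=> zv uz [vu|[z' [z'u vz']]].
    by apply: (lt_irr z); apply: uz; exact: le_trans zv vu.
  by apply: (lt_irr z); exact: lt_trans (vz' z zv) (uz z' z'u).
split => [[exy eyx]|[xy yx]]; last by split; left.
split.
  by case: exy => // -[z [zy xz]]; case: (irr _ _ _ zy xz).
by case: eyx => // -[z [zx yz]]; case: (irr _ _ _ zx yz).
Qed.

End Extension.

(** Both quantifiers range over countable predecessor sets, the universal one
    being the negation of an existential one. *)
Lemma dominated_extension_borel (R : realType) (X : topologicalType)
    (le lt : X -> X -> Prop) : polish R X -> borel_rel le -> borel_rel lt ->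
  (forall x, countable [set w | le w x]) ->
  borel_rel (dominated_extension le lt).
Proof.
move=> hX le_borel lt_borel le_count.
have dom_borel : borel_rel (fun x z => forall w, le w x -> lt w z).
  have nlt_borel : borel_rel (fun w z => ~ lt w z) by exact: sigma_not.
  have := borel_rel_exists_countable hX le_borel nlt_borel le_count.
  move=> /sigma_not; congr borel; apply/funext => -[x z]; apply/propext.
  split => /= [no w wx|h [w [wx]]]; last by apply; exact: h.
  by apply: contrapT => nwz; apply: no; exists w.
have ex_borel := borel_rel_swap
  (borel_rel_exists_countable hX le_borel (borel_rel_swap dom_borel) le_count).
exact: (sigma_or le_borel ex_borel).
Qed.

Theorem lemma4p7 (R : realType) (X : topologicalType) (hX : polish R X)
  (K L : Type) (hL : is_aleph0 L \/ is_aleph1 L)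
  (hdag : dagger X L K)
  (le : X -> X -> Prop) (hle : borel_quasi_order le)
  (hsmall : forall x : X, card_lt [set y | le y x] [set: L]) :
  exists M : Type, is_odimB le M /\ [set: M] #<= [set: K].
Proof.
suff realK : borel_realizer le K.
  have [M [realM Mmin]] := exists_minimal_cardinal realK.
  by exists M; split; [split|exact: Mmin].
have [le_qo le_borel] := hle; have [le_refl le_trans] := le_qo.
have [lt [ltP lt_sep]] := hdag.
pose ext i := dominated_extension le (lt i).
have ext_qo i : quasi_order (ext i).
  exact: dominated_extension_quasi_order (ltP i).1.
have extE i x y : qo_equiv (ext i) x y <-> qo_equiv le x y.
  exact: dominated_extension_equiv (ltP i).1 x y.
exists (fun i => @induced_lt X (qo_equiv le) (ext i)); split => [i|x y c].
  split; first split.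
  - by apply: induced_lt_partial_order => // x y; rewrite extE.
  - exists (ext i); split => //; split => //.
    apply: dominated_extension_borel hX le_borel (ltP i).2 _ => x.
    exact: countable_below hL (hsmall x).
  - move=> _ _ [x [y [-> -> [xy nyx]]]]; exists x, y; split => //.
    split; first by left.
    move=> eyx; have /extE[_ //] : qo_equiv (ext i) x y by split => //; left.
have [xy|nxy] := pselect (le x y).
  (* separating a point from the empty set shows that [K] is inhabited *)
  have [|//|i _] := lt_sep set0 x.
    have [_ nle] := hsmall x; split; first exact: card_ge0.
    by move=> /card_le_trans /(_ (card_ge0 _ _)).
  exists i; have [yx|nyx] := pselect (le y x).
    apply: Or33; apply: eq_cls => [u v []|u v w [uv vu] [vw wv]|] //.
    by split; [exact: le_trans uv vw|exact: le_trans wv vu].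
  by apply: Or32; exists x, y.
have [i iP] := lt_sep _ x (hsmall y) nxy.
exists i; apply: Or31; exists y, x; split => //.
have eyx : ext i y x by right; exists x.
split => // exy; apply: nxy; have /extE[] // : qo_equiv (ext i) x y by [].
Qed.
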